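(* For any prime $p \geq 5$ and integers $k, l \geq 1$, the congruence $$\mathrm{N}(\mathrm{P}(\mathbb{Z}/p^l\mathbb{Z})^k) = |\tilde{\Lambda}_{p^l}^k| \equiv 1 \pmod{p^2}$$ holds. In addition, if $p$ is a Wolstenholme prime, then $$\mathrm{N}(\Theta(\mathbb{Z}/p^l\mathbb{Z})) = \mathrm{N}(\mathrm{P}(\mathbb{Z}/p^l\mathbb{Z})) = |\tilde{\Lambda}_{p^l}^1| \equiv 1 \pmod{p^3}.$$
   Context: For a finite group $G = \{g_1, \ldots, g_n\}$, let $x_g$ ($g \in G$) be indeterminates. The group determinant and group permanent of $G$ are $$\Theta(G) := \det(x_{gh^{-1}})_{g,h \in G} = \sum_{\sigma \in \mathfrak{S}_n} \mathrm{sgn}(\sigma)\, x_{g_1 g_{\sigma(1)}^{-1}} \cdots x_{g_n g_{\sigma(n)}^{-1}}, \qquad \mathrm{P}(G) := \mathrm{perm}(x_{gh^{-1}})_{g,h \in G} = \sum_{\sigma \in \mathfrak{S}_n} x_{g_1 g_{\sigma(1)}^{-1}} \cdots x_{g_n g_{\sigma(n)}^{-1}},$$ both in $\mathbb{Z}[x_{g_1}, \ldots, x_{g_n}]$. For $f \in \mathbb{Z}[x_{g_1}, \ldots, x_{g_n}]$, $\mathrm{N}(f)$ denotes the number of terms in $f$, i.e. the number of distinct monomials with nonzero coefficient in $f$ after combining like terms. For positive integers $n,k$, $\tilde{\Lambda}_n^k$ is the set of $(\lambda_1, \ldots, \lambda_{kn}) \in \mathbb{Z}^{kn}$ with $1 \leq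 \lambda_1 \leq \lambda_2 \leq \cdots \leq \lambda_{kn} \leq n$ and $\lambda_1 + \cdots + \lambda_{kn} \equiv 0 \pmod n$. A Wolstenholme prime is a prime $p$ satisfying $\binom{2p-1}{p-1} \equiv 1 \pmod{p^4}$. *)

(* Defs.v *)
From HB Require Import structures.
From mathcomp Require Import all_boot all_order all_algebra all_fingroup.
From mathcomp Require Import mpoly.

Set Implicit Arguments.
Unset Strict Implicit.
Unset Printing Implicit Defensive.

Import GRing.Theory.
Local Open Scope ring_scope.

Definition permanent (R : comNzRingType) (n : nat) (A : 'M[R]_n) : R :=
  \sum_(s : 'S_n) \prod_(i < n) A i (s i).

(* The indeterminate x_g is 'X_(enum_rank g): the elements of gT are numbered
   by enum_rank / enum_val. *)
Definition group_matrix (gT : finGroupType) : 'M[{mpoly int[#|gT|]}]_#|gT| :=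
  \matrix_(i, j) 'X_(enum_rank (enum_val i * (enum_val j)^-1)%g).

Definition group_det (gT : finGroupType) : {mpoly int[#|gT|]} :=
  \det (group_matrix gT).

Definition group_perm (gT : finGroupType) : {mpoly int[#|gT|]} :=
  permanent (group_matrix gT).

Definition nterms (n : nat) (f : {mpoly int[n]}) : nat := size (msupp f).

(* Entries range over {1, ..., n}, encoded as the nonzero elements of
   'I_n.+1 = {0, ..., n}. *)
Definition tLambda (n k : nat) : {set (k * n).-tuple 'I_n.+1} :=
  [set t : (k * n).-tuple 'I_n.+1 |
    [&& all (fun x : 'I_n.+1 => (0 < x)%N) t,
        sorted (fun x y : 'I_n.+1 => (x <= y)%N) t
      & (n %| \sum_(x <- t) (x : nat))%N]].

Definition wolstenholme_prime (p : nat) : Prop :=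
  prime p /\ 'C(2 * p - 1, p - 1) = 1 %[mod p ^ 4].

(* Main.v *)
Require Import Defs.
From mathcomp Require Import all_boot all_order all_algebra all_fingroup all_field.
From mathcomp Require Import mpoly zify ring.

Set Implicit Arguments.
Unset Strict Implicit.
Unset Printing Implicit Defensive.

Import Order.TTheory GRing.Theory Num.Theory.
Local Open Scope ring_scope.

(** Let [n = p ^ l] and let [G] be the cyclic group of order [n], written additively. A
    monomial of degree [k * n] in the indeterminates is a multiset of [k * n] elements of
    [G]. A monomial of the determinant or of the permanent is the multiset of
    displacements [x - s x] of a permutation [s] of [G], so its elements sum to zero. The
    proof shows that conversely all zero-sum multisets occur, and then counts them.

    Determinant. The coefficient of the multiset [b], times the order of the stabilizer
    of [b], is the signed sum over all permutations [s] of [n] indices of the number of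
    [f] with [f (s i) = f i - b i] ([shift_sum_det]). Such [f] exist only if [b] has sum
    zero on each cycle of [s], and their number is [n] to the number of cycles. Grouping
    by the cycle through a fixed index ([shift_sum_block]) and comparing [p]-adic
    valuations, the contribution of the [n]-cycles, which is [n`!] up to sign, has
    strictly the smallest valuation ([shift_sum_valuation]); here it matters that [n] is a
    power of [p]. So every zero-sum multiset of size [n] has nonzero coefficient, in the
    determinant and a fortiori in the permanent.

    Powers of the permanent. Coefficients are nonnegative, so the support of the [k]-th
    power is the [k]-fold sumset of the support. By the Erdos-Ginzburg-Ziv theorem
    ([egz_ppow]) a zero-sum multiset of size [k * n] splits into [k] zero-sum multisets
    of size [n] ([zero_sum_mset_split]), so all of them occur. Sorting representatives in
    [1 .. n] identifies these multisets with [tLambda n k].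

    Counting. With roots of unity, [n] times the number of zero-sum multisets of size
    [k * n] is the sum over [j < n] of [C g], where [g = gcdn j n] and
    [C g = 'C(k * g + g - 1, k * g)] ([card_contents_eq]). Collecting equal values, the
    number itself is 1 plus the sum over [i < l] of
    [(C (p ^ i.+1) - C (p ^ i)) / p ^ i.+1]. A congruence of Wolstenholme type
    ([bin_ppow_congr]) shows that [p ^ (2 * i + 3)] divides the [i]-th numerator, so
    that all terms vanish modulo [p ^ 2], and all but the one for [i = 0] modulo
    [p ^ 3]. For [k = 1] the latter has numerator ['C(2 * p - 1, p - 1) - 1], which a
    Wolstenholme prime makes divisible by [p ^ 4]. *)

(** * Signed counts of functions shifted by a permutation *)

Section ShiftedPerm.

Variables (I : finType) (G : finZmodType).
Implicit Types (A B : {set I}) (b : I -> G) (s : {perm I}) (f g : {ffun I -> G}).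

(** For a permutation [s] of [A], a function [f] on [A] solves [f (s i) = f i - b i]
    only if [b] has sum zero on every cycle of [s], and then it has one free value per
    cycle: there are [#|G|] to the number of cycles of solutions. Counting solutions
    replaces all bookkeeping on cycles. Requiring [f = 0] off [A] makes the count
    independent of the ambient type. *)
Definition shift_sols A b s : {set {ffun I -> G}} :=
  [set f : {ffun I -> G} |
    [forall i, if i \in A then f (s i) == f i - b i else f i == 0]].

(** Up to a positive factor, the full sum [shift_sum setT b] is the coefficient in the
    group determinant of the monomial with exponents given by [b]
    (see [shift_sum_det]); the sums over smaller sets [A] serve the recursion. *)
Definition shift_sum A b : int :=
  \sum_(s : {perm I} | perm_on A s) (-1) ^+ s *+ #|shift_sols A b s|.

Definition ffun_update f i0 x : {ffun I -> G} :=
  [ffun i => if i == i0 then x else f i].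

Definition add_at b j x : I -> G := fun i => if i == j then b i + x else b i.

Lemma shift_solsP A b s f :
  reflect ((forall i, i \in A -> f (s i) = f i - b i) /\
           (forall i, i \notin A -> f i = 0)) (f \in shift_sols A b s).
Proof.
rewrite inE; apply: (iffP forallP) => [h | [h1 h2] i].
  by split=> i iA; move: (h i); rewrite ?iA ?(negbTE iA) => /eqP.
by case: ifPn => iA; apply/eqP; [apply: h1 | apply: h2].
Qed.

Lemma card_shift_sols_fix A b s i0 : i0 \in A -> perm_on (A :\ i0) s ->
  #|shift_sols A b s| =
    if b i0 == 0 then (#|G| * #|shift_sols (A :\ i0) b s|)%N else 0%N.
Proof.
move=> i0A son; have si0 : s i0 = i0 by apply: (out_perm son); rewrite !inE eqxx.
have nfix i : i != i0 -> s i != i0 by move=> ?; rewrite -si0 (inj_eq perm_inj).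
case: eqP => [b0|b0]; last first.
  apply: eq_card0 => f; apply/negP => /shift_solsP [h _].
  have := h _ i0A; rewrite si0 -{1}[f i0]addr0 => /addrI /esym /eqP.
  by rewrite oppr_eq0 => /eqP.
rewrite -cardsT -cardsX.
pose F (u : G * {ffun I -> G}) := ffun_update u.2 i0 u.1.
have -> : shift_sols A b s = F @: setX setT (shift_sols (A :\ i0) b s).
  apply/setP => f; apply/idP/imsetP => [/shift_solsP [h1 h2] | [[x g]]].
    exists (f i0, ffun_update f i0 0).
      rewrite !inE /=; apply/forallP => i; rewrite !inE !ffunE.
      case: eqP => //= /eqP ii0; case: ifP => iA; last by rewrite h2 ?iA.
      by rewrite (negbTE (nfix _ ii0)) h1.
    by apply/ffunP => i; rewrite !ffunE /=; case: eqP => [->|].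
  rewrite in_setX in_setT /= => /shift_solsP [h1 h2] ->; apply/shift_solsP.
  split=> i iA; rewrite !ffunE /=.
    case: (eqVneq i i0) => [->|ii0]; first by rewrite si0 eqxx b0 subr0.
    by rewrite (negbTE (nfix _ ii0)) h1 // !inE ii0.
  case: eqP => [ii0|_]; first by rewrite ii0 i0A in iA.
  by rewrite h2 // !inE (negbTE iA) andbF.
rewrite card_in_imset // => -[x g] [y h] /=.
rewrite !in_setX !in_setT /= => /shift_solsP [_ gh] /shift_solsP [_ hh].
rewrite /F => /ffunP /= e; congr (_, _); first by have := e i0; rewrite !ffunE eqxx.
apply/ffunP => i; case: (eqVneq i i0) => [->|ii0].
  by rewrite gh ?hh // !inE eqxx.
by have := e i; rewrite !ffunE (negbTE ii0).
Qed.

(** Removing [i0] from its cycle, where its predecessor is [j], moves the displacement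
    of [i0] to [j], and [f i0] is then determined by [f j]. *)
Lemma card_shift_sols_merge A b s i0 j :
    i0 \in A -> j \in A :\ i0 -> perm_on (A :\ i0) s ->
  #|shift_sols A b (tperm i0 j * s)%g| =
  #|shift_sols (A :\ i0) (add_at b j (b i0)) s|.
Proof.
move=> i0A; rewrite !inE => /andP[ji0 jA] son.
have si0 : s i0 = i0 by apply: (out_perm son); rewrite !inE eqxx.
have nfix i : i != i0 -> s i != i0 by move=> ?; rewrite -si0 (inj_eq perm_inj).
pose F g := ffun_update g i0 (g j - b j).
have -> : shift_sols A b (tperm i0 j * s)%g =
    F @: shift_sols (A :\ i0) (add_at b j (b i0)) s.
  apply/setP => f; apply/idP/imsetP => [/shift_solsP [h1 h2] | [g]].
    exists (ffun_update f i0 0).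
      apply/shift_solsP; split=> i; rewrite !inE !ffunE.
        case/andP=> ii0 iA; rewrite (negbTE (nfix _ ii0)) (negbTE ii0) /add_at.
        case: (eqVneq i j) => [->|ij].
          have := h1 _ i0A; have := h1 _ jA; rewrite !permM tpermL tpermR si0.
          by move=> -> ->; rewrite opprD addrA.
        by have := h1 _ iA; rewrite permM tpermD // eq_sym.
      by case: eqP => //= ii0 iA; rewrite h2.
    apply/ffunP => i; rewrite !ffunE (negbTE ji0); case: eqP => // ->.
    by have := h1 _ jA; rewrite permM tpermR si0.
  case/shift_solsP=> h1 h2 ->; apply/shift_solsP; split=> i iA; rewrite !ffunE.
    rewrite permM; case: tpermP => [->|->|/eqP ii0 /eqP ij].
    - rewrite (negbTE (nfix _ ji0)) eqxx h1 ?inE ?ji0 // /add_at eqxx.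
      by rewrite opprD addrA.
    - by rewrite si0 eqxx (negbTE ji0).
    - rewrite (negbTE (nfix _ ii0)) (negbTE ii0) h1 ?inE ?ii0 //.
      by rewrite /add_at (negbTE ij).
  case: eqP => [ii0|_]; first by rewrite ii0 i0A in iA.
  by rewrite h2 // !inE (negbTE iA) andbF.
rewrite card_in_imset // => g h /shift_solsP [_ gh] /shift_solsP [_ hh].
rewrite /F => /ffunP e; apply/ffunP => i; case: (eqVneq i i0) => [->|ii0].
  by rewrite gh ?hh // !inE eqxx.
by have := e i; rewrite !ffunE (negbTE ii0).
Qed.

Lemma perm_onD1 A i s : i \in A ->
  perm_on (A :\ i) s = perm_on A s && (s i == i).
Proof.
move=> iA; apply/idP/andP => [son | [son /eqP si]].
  split; last by apply/eqP/(out_perm son); rewrite !inE eqxx.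
  by apply: subset_trans son _; apply: subsetDl.
apply/subsetP => j; rewrite inE => sj; rewrite !inE (subsetP son) ?inE // andbT.
by apply: contraNneq sj => ->; rewrite si.
Qed.

(** Classify [s] by the preimage [j] of [i0]: either [i0] is a fixed point, which
    contributes one free value of [f], or it can be removed from its cycle by a
    transposition, which changes the sign. *)
Lemma shift_sum_contract A b i0 : i0 \in A ->
  shift_sum A b =
    (if b i0 == 0 then shift_sum (A :\ i0) b *+ #|G| else 0)
    - \sum_(j in A :\ i0) shift_sum (A :\ i0) (add_at b j (b i0)).
Proof.
move=> i0A; rewrite {1}/shift_sum.
rewrite (partition_big (fun s => (s^-1)%g i0) (mem A)) /=; last first.
  by move=> s son; rewrite -(perm_closed _ son) permKV.
rewrite (bigD1 i0) //=; congr (_ + _).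
  rewrite (eq_bigl (perm_on (A :\ i0))); last first.
    move=> s; rewrite perm_onD1 //; congr andb.
    by rewrite -(inj_eq (@perm_inj _ s)) permKV eq_sym.
  rewrite (eq_bigr (fun s => if b i0 == 0 then
    ((-1) ^+ s *+ #|shift_sols (A :\ i0) b s|) *+ #|G| else 0)); last first.
    move=> s son; rewrite (card_shift_sols_fix _ i0A son); case: ifP => // _.
    by rewrite mulnC mulrnA.
  by case: ifP => _; [rewrite sumrMnl | rewrite big1].
rewrite -sumrN; apply: eq_big => [j|j /andP[jA ji0]].
  by rewrite !inE andbC.
rewrite (reindex_inj (mulgI (tperm i0 j))) /= -sumrN.
have jAi : j \in A :\ i0 by rewrite !inE ji0.
rewrite (eq_bigl (perm_on (A :\ i0))) => [|s].
  apply: eq_bigr => s son; rewrite (card_shift_sols_merge _ i0A jAi son).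
  by rewrite odd_permM odd_tperm eq_sym ji0 signrN mulNrn.
rewrite perm_onD1 //.
have -> : ((tperm i0 j * s)^-1%g i0 == j) = (s i0 == i0).
  rewrite -(inj_eq (@perm_inj _ (tperm i0 j * s)%g)) permKV permM tpermR.
  by rewrite eq_sym.
congr andb.
have ton : perm_on A (tperm i0 j).
  apply: subset_trans (tperm_on _ _) _.
  by apply/subsetP => x; rewrite !inE => /orP[]/eqP->.
apply/idP/idP => [h|h]; last exact: perm_onM.
by have := perm_onM ton h; rewrite mulgA tperm2 mul1g.
Qed.


Lemma eq_shift_sum A b b' : {in A, b =1 b'} -> shift_sum A b = shift_sum A b'.
Proof.
move=> e; apply: eq_bigr => s _; congr (_ *+ _); apply: eq_card => f.
rewrite !inE; apply: eq_forallb => i; case: ifP => // iA; by rewrite e.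
Qed.

Lemma shift_sum0 b : shift_sum set0 b = 1.
Proof.
have e s : perm_on set0 s = (s == 1%g).
  apply/idP/eqP => [son|->]; last exact: perm_on1.
  by apply/permP => i; rewrite perm1 (out_perm son) ?inE.
rewrite /shift_sum (eq_bigl _ _ e) big_pred1_eq odd_perm1.
rewrite (_ : shift_sols _ _ _ = [set [ffun=> 0]]) ?cards1 //.
apply/setP => f; rewrite in_set1; apply/shift_solsP/eqP => [[_ h]|->].
  by apply/ffunP => i; rewrite ffunE h ?inE.
by split=> i; rewrite ?ffunE ?inE.
Qed.

(** [B] is the cycle of [i0]: there are [#|B|.-1`!] cyclic permutations of [B], each
    of sign [(-1) ^+ #|B|.-1] and each leaving [#|G|] choices for [f] on [B]. The
    formula is derived from the contraction rule, which avoids decomposing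
    permutations: a set [B] containing [i0] arises from the [#|B|.-1] possible
    predecessors of [i0] in [B], whence the factorial. *)
Lemma shift_sum_block A b i0 : i0 \in A ->
  shift_sum A b =
    \sum_(B : {set I} | [&& i0 \in B, B \subset A & \sum_(i in B) b i == 0])
      (-1) ^+ #|B|.-1 * (#|G| * #|B|.-1`!)%:R * shift_sum (A :\: B) b.
Proof.
have [m] := ubnP #|A|; elim: m A b i0 => // m IHm A b i0 ltAm i0A.
pose A' := A :\ i0; pose T B := shift_sum (A' :\: B) b.
have A'm : (#|A'| < m)%N by move: ltAm; rewrite (cardsD1 i0) i0A.
rewrite (reindex_onto (fun B => i0 |: B) (fun B => B :\ i0)) /=; last first.
  by move=> B /andP[i0B _]; rewrite setD1K.
rewrite (eq_big (fun B => (B \subset A') && (b i0 + \sum_(i in B) b i == 0))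
   (fun B => (-1) ^+ #|B| * (#|G| * #|B|`!)%:R * T B)); first last.
- move=> B /andP[/and3P[_ BA _] /eqP eB].
  have i0B : i0 \notin B by rewrite -eB !inE eqxx.
  by rewrite cardsU1 i0B /= /T /A' setDDl.
- move=> B; case i0B: (i0 \in B).
    rewrite [RHS](_ : _ = false); last first.
      by apply/negP => /andP[/subsetP/(_ _ i0B)]; rewrite !inE eqxx.
    by apply/negP => /andP[_ /eqP/setP/(_ i0)]; rewrite !inE eqxx i0B.
  have -> : ((i0 |: B) :\ i0 == B) by rewrite setU1K ?i0B.
  rewrite andbT setU11 /= big_setU1 ?i0B //=; congr andb.
  by rewrite subUset sub1set i0A subsetD1 i0B andbT.
(* Here [B] is the block without [i0]; the empty one comes from fixed points. *)
rewrite big_mkcondr (bigD1 set0) ?sub0set //= big_set0 addr0 (shift_sum_contract _ i0A).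
congr (_ + _).
  by case: ifP => // _; rewrite cards0 expr0 mul1r muln1 /T setD0 mulr_natl.
pose c B := b i0 + \sum_(i in B) b i == 0.
pose F B := - ((-1) ^+ #|B| * (#|G| * #|B|.-1`!)%:R * T B).
rewrite (eq_bigr (fun j => \sum_(B : {set I} | [&& j \in B, B \subset A' & c B])
    F B)); last first.
  move=> j jA'; rewrite (IHm _ _ j) //; apply: eq_big => [B|B].
    case: (boolP (j \in B)) => //= jB; congr andb; rewrite /c (big_setD1 j) //=.
    rewrite (big_setD1 j (A := B)) //= /add_at eqxx addrA [b i0 + _]addrC.
    congr (_ + _ == _); apply: eq_bigr => i; rewrite !inE => /andP[ij _].
    by rewrite (negbTE ij).
  move=> /and3P[jB BA _]; rewrite /F (cardsD1 j B) jB /= exprS mulN1r.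
  rewrite !mulNr opprK; congr (_ * _); apply: eq_shift_sum => i; rewrite !inE /add_at.
  by case: (eqVneq i j) => // ->; rewrite jB.
rewrite (exchange_big_dep (fun B : {set I} => (B \subset A') && (B != set0))) /=.
  rewrite -sumrN; apply: eq_bigr => B /andP[BA B0].
  rewrite -/(c B); case cB: (c B); last first.
    by rewrite big_pred0 ?oppr0 // => j; rewrite !andbF.
  rewrite (eq_bigl (mem B)); last first.
    move=> j; rewrite BA andbT /=; case jB: (j \in B); last by rewrite andbF.
    by rewrite andbT (subsetP BA).
  rewrite sumr_const -mulNrn opprK /F.
  have Bpos : (0 < #|B|)%N by rewrite card_gt0.
  have -> : (#|B|`! = #|B| * #|B|.-1`!)%N.
    by rewrite -[in LHS](prednK Bpos) factS prednK.
  by rewrite mulnCA [X in _ = _ * X * _]natrM -[LHS]mulr_natl; ring.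
move=> j B jA /and3P[jB -> _] /=; by apply/set0Pn; exists j.
Qed.

End ShiftedPerm.

(** * Valuation of the signed counts for a group of prime power order *)

Lemma logn_fact_lt p l m : prime p -> (m < p ^ l)%N ->
  logn p m`! = (\sum_(1 <= k < l) m %/ p ^ k)%N.
Proof.
move=> pp ml; rewrite logn_fact //.
have ext u v : (0 < u)%N -> (m < p ^ u)%N -> (\sum_(1 <= k < u + v) m %/ p ^ k)%N =
    (\sum_(1 <= k < u) m %/ p ^ k)%N.
  move=> u0 mu; rewrite (big_cat_nat (n := u)) ?leq_addr //=.
  rewrite [X in (_ + X)%N]big1_seq ?addn0 // => k.
  rewrite mem_index_iota => /andP[_ /andP[uk _]]; apply: divn_small.
  by apply: leq_trans mu _; rewrite leq_pexp2l ?prime_gt0.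
case: l ml => [|l] ml; first by rewrite expn0 ltnS leqn0 in ml; rewrite (eqP ml) !big_geq.
rewrite -(ext l.+1 m.+1) // addnC ext //.
by apply: leq_trans (ltn_expl m (prime_gt1 pp)) _; rewrite leq_pexp2l ?prime_gt0.
Qed.

(** This is the strict inequality which makes one long cycle dominate two shorter ones.
    By Legendre's formula the two sides differ by a sum over the powers of [p] below
    [p ^ l] in which every term is at most one, and there are [l.-1] such powers. *)
Lemma logn_fact_merge p l a b : prime p -> (0 < a)%N -> (0 < b)%N ->
  (a + b <= p ^ l)%N ->
  (logn p (a + b).-1`! < l + logn p a.-1`! + logn p b.-1`!)%N.
Proof.
move=> pp a0 b0 ab.
have l0 : (0 < l)%N by case: l ab => // ; rewrite expn0; lia.
rewrite !(@logn_fact_lt p l) //; try lia.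
suff: (\sum_(1 <= k < l) (a + b).-1 %/ p ^ k <= \sum_(1 <= k < l) 1 +
    (\sum_(1 <= k < l) a.-1 %/ p ^ k + \sum_(1 <= k < l) b.-1 %/ p ^ k))%N.
  by rewrite sum_nat_const_nat muln1; do 3 move: (\sum_(_ <= _ < _) _)%N => ?; lia.
rewrite -!big_split /= leq_sum // => k _.
have q0 : (0 < p ^ k)%N by rewrite expn_gt0 prime_gt0.
move: (p ^ k)%N q0 => q q0.
rewrite -ltnS ltn_divLR //; move: (ltn_ceil a.-1 q0) (ltn_ceil b.-1 q0).
by move: (a.-1 %/ q)%N (b.-1 %/ q)%N => u v; nia.
Qed.

Section PrimePowerShift.

Variables (I : finType) (G : finZmodType) (p l : nat).
Hypotheses (pp : prime p) (cardG : #|G| = (p ^ l)%N).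

(** In the cycle expansion of [shift_sum A b] the term in which all of [A] is a single
    cycle has strictly smaller [p]-adic valuation than all the others: splitting a
    cycle gains a factor [p ^ l] for the new free value and loses less in the
    factorials, by [logn_fact_merge]. *)
Lemma shift_sum_valuation (A : {set I}) (b : I -> G) :
  (0 < #|A| <= p ^ l)%N -> \sum_(i in A) b i = 0 ->
  (((p ^ (l + logn p #|A|.-1`!).+1)%N : int) %|
     shift_sum A b - (-1) ^+ #|A|.-1 * (#|G| * #|A|.-1`!)%:R)%Z.
Proof.
have [m] := ubnP #|A|; elim: m A => // m IHm A ltAm /andP[A0 Al] sA.
have [i0 i0A] := card_gt0P A0.
rewrite (shift_sum_block _ i0A) (bigD1 A) /=; last by rewrite i0A subxx sA eqxx.
rewrite setDv shift_sum0 mulr1 addrAC subrr add0r.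
apply: rpred_sum => B /andP[/and3P[i0B BA /eqP sB] BneA].
have cAB := cardsID B A; rewrite (setIidPr BA) in cAB.
have B0 : (0 < #|B|)%N by apply/card_gt0P; exists i0.
have AB0 : (0 < #|A :\: B|)%N.
  by rewrite card_gt0 setD_eq0; apply: contraNN BneA => AB; rewrite eqEsubset BA.
have [q qV] : exists q : int,
    shift_sum (A :\: B) b = q * (p ^ (l + logn p #|A :\: B|.-1`!))%:R.
  have sAB : \sum_(i in A :\: B) b i = 0.
    by move: sA; rewrite (big_setID B) /= (setIidPr BA) sB add0r.
  have := IHm (A :\: B) ltac:(lia) ltac:(lia) sAB.
  move=> /dvdzP [q eq]; move/(canRL (subrK _)): eq => ->.
  have /dvdnP [r er] : (p ^ (l + logn p #|A :\: B|.-1`!) %| #|G| * #|A :\: B|.-1`!)%N.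
    by rewrite cardG expnD dvdn_mul // pfactor_dvdnn.
  exists (q * p%:Z + (-1) ^+ #|A :\: B|.-1 * r%:Z).
  by rewrite er expnS -[_ %:Z]natz natrM -!natz natrM; ring.
have /dvdnP [r er] : (p ^ (l + logn p #|B|.-1`!) %| #|G| * #|B|.-1`!)%N.
  by rewrite cardG expnD dvdn_mul // pfactor_dvdnn.
have hv := @logn_fact_merge p l #|B| #|A :\: B| pp B0 AB0 ltac:(lia).
have /dvdnP [t et] : (p ^ (l + logn p #|A|.-1`!).+1 %|
    p ^ (l + logn p #|B|.-1`!) * p ^ (l + logn p #|A :\: B|.-1`!))%N.
  by rewrite -expnD dvdn_exp2l // -cAB; lia.
apply/dvdzP; exists ((-1) ^+ #|B|.-1 * r%:R * q * t%:R).
rewrite qV er natrM -[X in _ = _ * X]natz.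
have : (p ^ (l + logn p #|B|.-1`!))%:R * (p ^ (l + logn p #|A :\: B|.-1`!))%:R =
   t%:R * (p ^ (l + logn p #|A|.-1`!).+1)%:R :> int by rewrite -!natrM et.
set x := (_ ^ _)%:R; set y := (_ ^ _)%:R; set z := (_ ^ _)%:R => exy.
by transitivity ((-1) ^+ #|B|.-1 * r%:R * q * (x * y)); [ring | rewrite exy; ring].
Qed.

End PrimePowerShift.

(** * Coefficients of the determinant of the matrix of differences *)

Section CirculantCoefficient.

Variable G : finZmodType.
Let n := #|G|.
Let ev : 'I_n -> G := enum_val.

(** The exponent vector of the monomial [\prod_(x <- s) 'X_x]; multisets of elements of
    [G] are handled through lists representing them. *)
Definition mset (s : seq G) : 'X_{1..#|G|} := (\sum_(x <- s) U_(enum_rank x))%MM.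

Lemma msetE s i : mset s i = count_mem (enum_val i) s.
Proof.
elim: s => [|x s IHs]; first by rewrite /mset big_nil mnm0E.
rewrite /mset big_cons mnmDE -/(mset s) IHs mnm1E /=; congr (_ + _)%N.
by rewrite -(inj_eq enum_val_inj) enum_rankK.
Qed.

Lemma mset_perm_eq s t : (mset s == mset t) = perm_eq s t.
Proof.
apply/eqP/idP => [e|st]; last exact: perm_big.
by apply/allP => x _ /=; rewrite -(enum_rankK x) -!msetE e.
Qed.

Lemma mset_cat s t : mset (s ++ t) = (mset s + mset t)%MM.
Proof. by rewrite /mset big_cat. Qed.

(** The group matrix in additive notation. *)
Definition diff_matrix : 'M[{mpoly int[#|G|]}]_#|G| :=
  \matrix_(i, j) 'X_(enum_rank (ev i - ev j)).

Definition diffs (s : 'S_n) : n.-tuple G := [tuple ev i - ev (s i) | i < n].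

Lemma prod_diff_matrix (s : 'S_n) :
  \prod_i diff_matrix i (s i) = 'X_[mset (diffs s)].
Proof.
rewrite /mset -mprodXE big_tuple; apply: eq_bigr => i _.
by rewrite mxE tnth_mktuple.
Qed.

(** Composing [s] with the transposition of two points where [f] agrees does not change
    [f (s i)], and reverses the sign. *)
Lemma sum_sign_noninj (I : finType) (b : I -> G) (f : {ffun I -> G}) :
  ~~ injectiveb f ->
  \sum_(s : {perm I} | [forall i, f (s i) == f i - b i]) (-1) ^+ s = 0 :> int.
Proof.
move/injectivePn => [x [y xy fxy]].
set S := (X in X = _); suff : S = - S by lia.
rewrite [LHS](reindex_inj (mulIg (tperm x y))) -sumrN /=.
apply: eq_big => [s|s _]; last by rewrite odd_permM odd_tperm xy addbT signrN.
apply: eq_forallb => i; rewrite permM; congr (_ == _).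
by case: tpermP => [->|->|].
Qed.

(** The rearrangements turning the list [d] into [b] form a coset of the stabilizer of
    [b], so their number depends on [b] alone as soon as there is one. *)
Lemma card_perm_match (b : 'I_n -> G) (d : n.-tuple G) :
  #|[set s : 'S_n | [forall i, b i == tnth d (s i)]]| =
  if perm_eq [tuple b i | i < n] d
  then #|[set s : 'S_n | [forall i, b i == b (s i)]]| else 0%N.
Proof.
case: tuple_permP => [[s0 e]|ne]; last first.
  apply: eq_card0 => s; rewrite inE; apply/negP => /forallP h; apply: ne; exists s.
  by congr val; apply: eq_mktuple => i; rewrite (eqP (h i)).
have {}e i : b i = tnth d (s0 i).
  by have /val_inj/(congr1 (fun t => tnth t i)) := e; rewrite !tnth_mktuple.
rewrite -[RHS](card_imset _ (mulIg s0)); apply: eq_card => s.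
rewrite inE; apply/forallP/imsetP => [h | [r]].
  exists (s * s0^-1)%g; last by rewrite mulgKV.
  by rewrite inE; apply/forallP => i; rewrite [b (_ _)]e permM permKV.
rewrite inE => /forallP h -> i; by rewrite permM (eqP (h i)) e.
Qed.

Lemma coef_det_diff_matrix m :
  (\det diff_matrix)@_m = \sum_(s : 'S_n | mset (diffs s) == m) (-1) ^+ s.
Proof.
rewrite /determinant raddf_sum /= [RHS]big_mkcond /=; apply: eq_bigr => s _.
rewrite prod_diff_matrix; case: (odd_perm s).
  by rewrite expr1 mulN1r mcoeffN mcoeffX; case: eqP => _; rewrite ?oppr0.
by rewrite expr0 mul1r mcoeffX; case: eqP.
Qed.

(** Exchange the two sums in [shift_sum]. For a non-injective [f] the inner sum vanishes
    by [sum_sign_noninj]. An injective [f] is a renumbering of [G], and conjugating [s]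
    by it turns the equation into: the displacements of [s], suitably reordered,
    are [b]. The stabilizer of [b] counts the suitable orderings. *)
Lemma shift_sum_det (b : 'I_n -> G) :
  shift_sum setT b = (\det diff_matrix)@_(mset [tuple b i | i < n])
    *+ #|[set s : 'S_n | [forall i, b i == b (s i)]]|.
Proof.
pose ok (f : {ffun 'I_n -> G}) (s : 'S_n) := [forall i, f (s i) == f i - b i].
have -> : shift_sum setT b =
    \sum_(f : {ffun 'I_n -> G}) \sum_(s : 'S_n | ok f s) (-1) ^+ s.
  rewrite (exchange_big_dep predT) //= /shift_sum.
  apply: eq_big => [s|s _]; first by apply/subsetP => i _; rewrite in_setT.
  rewrite -sumr_const; apply: eq_bigl => f; rewrite inE.
  by apply: eq_forallb => i; rewrite in_setT.
(* Only the injective [f] contribute, and these are the renumberings [h r] of [G]. *)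
rewrite (bigID (fun f : {ffun 'I_n -> G} => injectiveb f)) /=.
rewrite [X in _ + X]big1 ?addr0; last by move=> f; exact: sum_sign_noninj.
pose h (r : 'S_n) : {ffun 'I_n -> G} := [ffun i => ev (r i)].
have hinj : injective h.
  move=> r1 r2 /ffunP e; apply/permP => i; apply: enum_val_inj.
  by have := e i; rewrite !ffunE.
rewrite (eq_bigl (mem (h @: setT))); last first.
  move=> f; apply/injectiveP/imsetP => [finj | [r _ ->] i j]; last first.
    by rewrite !ffunE => /enum_val_inj/perm_inj.
  have finj' : injective (enum_rank \o f) by apply: inj_comp => //; exact: enum_rank_inj.
  exists (perm finj') => //; apply/ffunP => i.
  by rewrite ffunE permE /= /ev enum_rankK.
rewrite big_imset /=; last by move=> ? ? _ _; exact: hinj.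
rewrite coef_det_diff_matrix -sumrMnl.
transitivity (\sum_(r in [set: 'S_n]) \sum_(s : 'S_n |
    [forall i, b i == tnth (diffs s) (r i)]) (-1) ^+ s : int).
  apply: eq_bigr => r _; rewrite (reindex_inj (conjg_inj r^-1%g)) /=.
  apply: eq_big => [s|s _]; last by rewrite odd_permJ.
  apply: eq_forallb => i; rewrite !ffunE tnth_mktuple.
  rewrite conjgE invgK !permM permKV.
  by apply/eqP/eqP => ->; rewrite opprB addrC subrK.
rewrite (exchange_big_dep predT) //= [RHS]big_mkcond /=; apply: eq_bigr => s _.
rewrite (eq_bigl (mem [set r : 'S_n | [forall i, b i == tnth (diffs s) (r i)]])).
  by rewrite sumr_const card_perm_match mset_perm_eq perm_sym; case: ifP.
by move=> r; rewrite in_setT /= inE.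
Qed.

End CirculantCoefficient.

(** * Supports of the determinant and of the permanent *)

Section Support.

Variable G : finZmodType.
Let n := #|G|.

Definition zero_sum_mset k (m : 'X_{1..#|G|}) :=
  exists t : seq G, [/\ size t = (k * #|G|)%N, \sum_(x <- t) x = 0 & m = mset t].

(** The displacements of a permutation sum to zero, since both ends run over [G]. *)
Lemma zero_sum_diffs (s : 'S_n) : zero_sum_mset 1 (mset (diffs s)).
Proof.
exists (diffs s); split=> //; first by rewrite size_tuple mul1n.
rewrite big_map big_enum /= big_split /= sumrN.
by rewrite [X in X - _](reindex_inj (@perm_inj _ s)) subrr.
Qed.

(** If the coefficient vanished then so would [shift_sum setT b], contradicting
    [shift_sum_valuation], since the single cycle term [#|G|`!] is nonzero and has
    smaller valuation than the rest. *)
Lemma msupp_det_diff_matrix p l m : prime p -> #|G| = (p ^ l)%N ->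
  (m \in msupp (\det (diff_matrix G))) <-> zero_sum_mset 1 m.
Proof.
move=> pp cardG; rewrite mcoeff_msupp; split=> [|[t [st sumt ->]]].
  rewrite coef_det_diff_matrix; case: (pickP (fun s : 'S_n => mset (diffs s) == m)).
    by move=> s /eqP <- _; apply: zero_sum_diffs.
  by move=> e; rewrite big_pred0 ?eqxx.
rewrite mul1n in st; pose b (i : 'I_n) := tnth (tcast st (in_tuple t)) i.
have bt : [tuple b i | i < n] = t :> seq G.
  by rewrite /= map_tnth_enum val_tcast.
have n0 : (0 < n)%N by apply/card_gt0P; exists 0.
apply/eqP => c0; have := shift_sum_det b; rewrite bt c0 mul0rn => V0.
have cT : (0 < #|[set: 'I_n]| <= p ^ l)%N by rewrite cardsT card_ord -cardG n0 leqnn.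
have sb : \sum_(i in [set: 'I_n]) b i = 0.
  rewrite -[RHS]sumt -bt big_tuple; apply: eq_big => [i|i _]; first by rewrite in_setT.
  by rewrite tnth_mktuple.
have := shift_sum_valuation pp cardG cT sb.
rewrite V0 sub0r dvdzE abszN abszMsign natz /= cardsT card_ord -/n.
rewrite pfactor_dvdn ?muln_gt0 ?fact_gt0 ?n0 // lognM ?fact_gt0 //.
have -> : logn p n = l by rewrite /n cardG pfactorK.
by rewrite ltnn.
Qed.

Lemma coef_permanent_diff_matrix m :
  (permanent (diff_matrix G))@_m = #|[set s : 'S_n | mset (diffs s) == m]|%:R.
Proof.
rewrite /permanent raddf_sum /= -sumr_const big_mkcond /= [RHS]big_mkcond /=.
apply: eq_bigr => s _; rewrite prod_diff_matrix mcoeffX inE; by case: eqP.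
Qed.

(** A monomial of the determinant comes from some permutation, hence also appears in the
    permanent, where nothing can cancel. This gives a special case of a theorem of
    Hall: every zero-sum list of length [#|G|] is a list of displacements. *)
Lemma msupp_permanent_diff_matrix p l m : prime p -> #|G| = (p ^ l)%N ->
  (m \in msupp (permanent (diff_matrix G))) <-> zero_sum_mset 1 m.
Proof.
move=> pp cardG; rewrite mcoeff_msupp coef_permanent_diff_matrix pnatr_eq0 -lt0n.
split=> [/card_gt0P [s] | /(msupp_det_diff_matrix _ pp cardG)].
  by rewrite inE => /eqP <-; apply: zero_sum_diffs.
rewrite mcoeff_msupp coef_det_diff_matrix => c0; apply/card_gt0P.
case: (pickP (fun s : 'S_n => mset (diffs s) == m)) => [s sm|e].
  by exists s; rewrite inE.
by rewrite big_pred0 ?eqxx in c0.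
Qed.

End Support.

Lemma msuppM_nneg (n : nat) (f g : {mpoly int[n]}) m :
  (forall m, 0 <= f@_m) -> (forall m, 0 <= g@_m) ->
  (m \in msupp (f * g)) <->
  exists m1 m2, [/\ m1 \in msupp f, m2 \in msupp g & m = (m1 + m2)%MM].
Proof.
move=> f0 g0; split.
  by move=> /msuppM_le/allpairsP [[m1 m2] [/= h1 h2 ->]]; exists m1, m2.
move=> [m1 [m2 [h1 h2 ->]]].
rewrite mcoeff_msupp mpolyME raddf_sum /= gt_eqF //.
rewrite (bigD1_seq (m1, m2)) /=; first last.
- by apply: allpairs_uniq; rewrite ?msupp_uniq // => -[? ?] [? ?].
- by apply/allpairsP; exists (m1, m2).
rewrite mcoeffZ mcoeffX eqxx mulr1 ltr_wpDr //.
  by apply: sumr_ge0 => ? _; rewrite mcoeffZ mcoeffX !mulr_ge0.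
by rewrite mulr_gt0 // lt0r -mcoeff_msupp ?h1 ?h2 ?f0 ?g0.
Qed.

Lemma coef_exp_nneg (n : nat) (f : {mpoly int[n]}) k m :
  (forall m, 0 <= f@_m) -> 0 <= (f ^+ k)@_m.
Proof.
move=> f0; elim: k m => [|k IHk] m; first by rewrite expr0 mcoeff1.
rewrite exprS mcoeffM sumr_ge0 // => u _; by rewrite mulr_ge0.
Qed.

(** * The Erdos-Ginzburg-Ziv theorem for prime powers *)

Section ErdosGinzburgZiv.

Local Open Scope nat_scope.

(** The Erdos-Ginzburg-Ziv property. Weighted elements of an arbitrary type, rather than
    bare integers, let the property be applied to lists of lists. *)
Definition egz n := forall (T : eqType) (w : T -> nat) (s : seq T),
  2 * n - 1 <= size s ->
  exists s1 s2, [/\ perm_eq s (s1 ++ s2), size s1 = n & n %| \sum_(x <- s1) w x].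

(** Extract [2 * b - 1] disjoint lists of length [a] whose weights are divisible by
    [a], divide these weights by [a], and apply the property for [b] to them. *)
Lemma egz_mul a b : 0 < a -> 0 < b -> egz a -> egz b -> egz (a * b).
Proof.
move=> a0 b0 ea eb T w s hs.
pose good (u : seq T) := (size u == a) && (a %| \sum_(x <- u) w x).
have cut r (t : seq T) : a * r + a - 1 <= size t ->
    exists ss rest, [/\ perm_eq t (flatten ss ++ rest), size ss = r & all good ss].
  elim: r t => [|r IHr] t ht; first by exists [::], t.
  have [|t1 [t2 [pt st dt]]] := ea T w t; first by nia.
  have [|ss [rest [pt2 sss gss]]] := IHr t2.
    by have := perm_size pt; rewrite size_cat st; nia.
  exists (t1 :: ss), rest; split; rewrite /= ?sss //; last by rewrite /good st eqxx dt.
  by rewrite (permPl pt) -catA perm_cat2l.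
have [|ss [rest [ps sss /allP gss]]] := cut (2 * b - 1) s; first by nia.
have [|ss1 [ss2 [pss sss1 d1]]] :=
    eb (seq T) (fun u => (\sum_(x <- u) w x) %/ a) ss; first by rewrite sss.
have g1 u : u \in ss1 -> good u.
  by move=> u1; apply: gss; rewrite (perm_mem pss) mem_cat u1.
exists (flatten ss1), (flatten ss2 ++ rest); split.
- by rewrite (permPl ps) catA -flatten_cat perm_cat2r perm_flatten.
- rewrite size_flatten /shape sumnE big_map.
  rewrite (eq_big_seq (fun=> a)) => [|u /g1 /andP[/eqP]] //.
  by rewrite big_const_seq count_predT sss1 iter_addn_0.
- have -> : \sum_(x <- flatten ss1) w x = a * \sum_(u <- ss1) (\sum_(x <- u) w x) %/ a.
    rewrite big_flatten big_distrr /=; apply: eq_big_seq => u /g1 /andP[_ d].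
    by rewrite mulnC divnK.
  by rewrite dvdn_pmul2l.
Qed.

Section EgzPrime.

Variables (p : nat) (pp : prime p).

(** The case of the Cauchy-Davenport theorem where one set has two elements: if no element
    is gained then [A] is invariant under translation by [a - b], which generates
    the additive group. *)
Lemma card_translateU (A : {set 'F_p}) (a b : 'F_p) : A != set0 -> a != b ->
  minn p #|A|.+1 <= #|[set (a + x)%R | x in A] :|: [set (b + x)%R | x in A]|.
Proof.
move=> /set0Pn [c cA] ab.
have cT (d : 'F_p) : #|[set (d + x)%R | x in A]| = #|A|.
  by rewrite card_imset //; apply: addrI.
rewrite geq_min; case: (ltnP #|A| _) => [_|le]; first by rewrite orbT.
have eqT (d : 'F_p) (B : {set 'F_p}) :
    [set (d + x)%R | x in A] \subset B -> #|B| <= #|A| ->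
    [set (d + x)%R | x in A] = B.
  by move=> sB lB; apply/eqP; rewrite eqEcard sB cT.
have ea := eqT _ _ (subsetUl _ _) le; have eb := eqT _ _ (subsetUr _ _) le.
(* Both translates equal their union, so translating by [a - b] preserves [A]. *)
have step x : x \in A -> (x + (a - b))%R \in A.
  move=> xA; have : (a + x)%R \in [set (b + x)%R | x in A].
    by rewrite eb -ea; apply: imset_f.
  case/imsetP => y yA e.
  by rewrite (_ : (x + (a - b))%R = y) // addrCA addrA e addrC addKr.
have all_in k : (c + (a - b) *+ k)%R \in A.
  by elim: k => [|k IHk]; rewrite ?mulr0n ?addr0 // mulrSr addrA step.
apply/orP; left; rewrite -ea cT -[X in X <= _](card_Fp pp) -cardsT subset_leq_card //.
apply/subsetP => x _; have := all_in ((x - c) / (a - b))%R.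
by rewrite -mulr_natr natr_Zp mulrC divfK ?subr_eq0 // addrC subrK.
Qed.

Variables (T : eqType) (w : T -> nat).

Fixpoint choice_sums (L : seq (T * T)) : {set 'F_p} :=
  if L is u :: L' then
    [set ((w u.1)%:R + x)%R | x in choice_sums L'] :|:
    [set ((w u.2)%:R + x)%R | x in choice_sums L']
  else [set 0%R].

Lemma choice_sums_neq0 L : choice_sums L != set0.
Proof.
elim: L => [|u L /set0Pn [x xL]] /=; apply/set0Pn; first by exists 0%R; rewrite inE.
by exists ((w u.1)%:R + x)%R; rewrite inE imset_f.
Qed.

Lemma card_choice_sums L :
  all (fun u => w u.1 != w u.2 %[mod p]) L ->
  minn p (size L).+1 <= #|choice_sums L|.
Proof.
elim: L => [|u L IHL] /=; first by rewrite cards1 geq_minr.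
case/andP => du /IHL {}IHL.
apply: leq_trans (card_translateU (choice_sums_neq0 L) _); first by lia.
by apply: contraNneq du => /(congr1 val); rewrite /= !val_Fp_nat // => ->.
Qed.

Lemma choice_sumsP L c : c \in choice_sums L ->
  exists s1 s2, [/\ perm_eq (unzip1 L ++ unzip2 L) (s1 ++ s2),
    size s1 = size L & (\sum_(x <- s1) w x)%:R = c :> 'F_p].
Proof.
elim: L c => [|[x y] L IHL] c /=.
  by rewrite inE => /eqP ->; exists [::], [::]; rewrite big_nil.
rewrite inE => /orP[] /imsetP [d /IHL [s1 [s2 [ps ss sd]]] ->].
  exists (x :: s1), (y :: s2); rewrite /= ss big_cons natrD sd; split=> //.
  by apply/seq.permP => a; have /seq.permP/(_ a) := ps; rewrite /= !count_cat /=; lia.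
exists (y :: s1), (x :: s2); rewrite /= ss big_cons natrD sd; split=> //.
by apply/seq.permP => a; have /seq.permP/(_ a) := ps; rewrite /= !count_cat /=; lia.
Qed.

End EgzPrime.

(** Sort the list by residues modulo [p] and pair the [i]-th element with the one
    [p.-1] places further. If some pair agrees modulo [p], then so do the [p] elements
    between its ends, whose sum is divisible by [p]. Otherwise the [p.-1] pairs realize
    all residues by [card_choice_sums], in particular the one completing the last
    element. *)
Lemma egz_prime p : prime p -> egz p.
Proof.
move=> pp T w s0 hs0; have p1 := prime_gt1 pp.
pose r x y := w x %% p <= w y %% p.
have [s [ps0 so hs]] : exists s, [/\ perm_eq s0 s, sorted r s & 2 * p - 1 <= size s].
  exists (sort r s0); rewrite perm_sym perm_sort size_sort; split=> //.
  by apply: sort_sorted => x y; apply: leq_total.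
suff [s1 [s2 [ps ss ds]]] : exists s1 s2,
    [/\ perm_eq s (s1 ++ s2), size s1 = p & p %| \sum_(x <- s1) w x].
  by exists s1, s2; split=> //; apply: perm_trans ps0 ps.
have [x0 _] : exists x, x \in s.
  by case: s hs {so ps0} => [|x s] /=; [lia | exists x; rewrite inE eqxx].
have mono i j : i <= j -> j < size s -> w (nth x0 s i) %% p <= w (nth x0 s j) %% p.
  move=> ij js; apply: (sorted_leq_nth _ _ x0 so) => //; rewrite ?inE //.
  - by move=> x y z; apply: leq_trans.
  - by move=> x; rewrite /r.
  - exact: leq_ltn_trans ij js.
pose L := zip (take p.-1 s) (take p.-1 (drop p.-1 s)).
have sz1 : size (take p.-1 s) = p.-1 by rewrite size_takel //; lia.
have sz2 : size (take p.-1 (drop p.-1 s)) = p.-1 by rewrite size_takel // size_drop; lia.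
have szL : size L = p.-1 by rewrite size_zip sz1 sz2 minnn.
case: (boolP (all (fun u => w u.1 != w u.2 %[mod p]) L)) => [allL | ].
  have := card_choice_sums pp allL; rewrite szL prednK ?prime_gt0 // minnn.
  rewrite -[X in X <= _](card_Fp pp) -cardsT => cT.
  have fT : choice_sums p w L = setT by apply/eqP; rewrite eqEcard subsetT.
  pose z := nth x0 s (2 * p.-1).
  have /(choice_sumsP pp) [s1 [s2 [ps12 ss1 sw]]] :
      (- (w z)%:R : 'F_p)%R \in choice_sums p w L.
    by rewrite fT in_setT.
  exists (z :: s1), (s2 ++ drop (2 * p.-1).+1 s); split.
  - rewrite -[s in perm_eq s _](cat_take_drop (2 * p.-1)) (drop_nth x0); last by lia.
    rewrite -/z [take _ s](_ : _ = take p.-1 s ++ take p.-1 (drop p.-1 s)); last first.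
      by rewrite -takeD addnn mul2n.
    move: ps12; rewrite unzip1_zip ?unzip2_zip ?sz1 ?sz2 // => /seq.permP ps12.
    by apply/seq.permP => a; have := ps12 a; rewrite /= !count_cat /=; lia.
  - by rewrite /= ss1 szL prednK // prime_gt0.
  - rewrite big_cons (dvdn_pcharf (pchar_Fp pp)) natrD sw.
    by rewrite GRing.subrr.
case/allPn => u /(nthP (x0, x0)) [i]; rewrite szL => iL.
rewrite nth_zip ?sz1 ?sz2 // !nth_take // nth_drop => <- /= /negPn/eqP e.
exists (take p (drop i s)), (take i s ++ drop (i + p) s); split.
- rewrite -{1}(cat_take_drop i s) -{1}(cat_take_drop p (drop i s)).
  by rewrite drop_drop addnC perm_catCA.
- by rewrite size_takel // size_drop; lia.
have sz : size (take p (drop i s)) = p by rewrite size_takel // size_drop; lia.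
rewrite /dvdn (big_nth x0) sz big_mkord -modn_summ.
rewrite (eq_bigr (fun=> w (nth x0 s i) %% p)) => [|j _].
  by rewrite sum_nat_const card_ord modnMr.
have jp := ltn_ord j; rewrite nth_take // nth_drop; apply/eqP; rewrite eqn_leq.
by rewrite [in X in X && _]e !mono ?leq_addr //; lia.
Qed.

Lemma egz_ppow p l : prime p -> egz (p ^ l).
Proof.
move=> pp; elim: l => [|l IHl].
  move=> T w [|x s] //= _; exists [:: x], s; split=> //.
rewrite expnS; apply: egz_mul => //; first exact: prime_gt0.
  by rewrite expn_gt0 prime_gt0.
exact: egz_prime.
Qed.

End ErdosGinzburgZiv.

(** * Supports over a cyclic group of prime power order *)

Section CyclicSupport.

Variables (p l : nat) (pp : prime p) (l0 : (0 < l)%N).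

Let n1 : (1 < p ^ l)%N.
Proof. by rewrite -(expn0 p) ltn_exp2l ?prime_gt1. Qed.

Lemma card_Zppow : #|'Z_(p ^ l)| = (p ^ l)%N.
Proof. by rewrite card_ord Zp_cast. Qed.

Lemma sum_Zppow_eq0 (t : seq 'Z_(p ^ l)) :
  (\sum_(x <- t) x == 0) = (p ^ l %| \sum_(x <- t) x)%N.
Proof.
have -> : \sum_(x <- t) x = (\sum_(x <- t) (x : nat))%:R :> 'Z_(p ^ l).
  by rewrite natr_sum; apply: eq_bigr => x _; rewrite natr_Zp.
by rewrite /dvdn -val_Zp_nat.
Qed.

(** For [k > 0] a zero-sum list of length [k.+1 * p ^ l] is long enough for the
    Erdos-Ginzburg-Ziv theorem, and what remains after the extraction again sums to
    zero. *)
Lemma zero_sum_mset_split k (m : 'X_{1..#|'Z_(p ^ l)|}) :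
  zero_sum_mset k.+1 m <->
  exists m1 m2, [/\ zero_sum_mset 1 m1, zero_sum_mset k m2 & m = (m1 + m2)%MM].
Proof.
split=> [[t [st sumt ->]]|]; last first.
  move=> [_ [_ [[t1 [s1 sum1 ->]] [t2 [s2 sum2 ->]] ->]]].
  exists (t1 ++ t2); rewrite size_cat s1 s2 big_cat /= sum1 sum2 addr0 mset_cat.
  by rewrite mul1n mulSn.
have [t1 [t2 [pt s1 sum1]]] : exists t1 t2, [/\ perm_eq t (t1 ++ t2),
    size t1 = #|'Z_(p ^ l)| & \sum_(x <- t1) x = 0].
  case: k st => [|k] st; first by exists t, [::]; rewrite cats0 st mul1n.
  have [|t1 [t2 [pt s1 d1]]] := @egz_ppow p l pp _ (@nat_of_ord _) t.
    by rewrite st card_Zppow; lia.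
  by exists t1, t2; rewrite card_Zppow; split=> //; apply/eqP; rewrite sum_Zppow_eq0.
exists (mset t1), (mset t2); split.
- by exists t1; rewrite mul1n.
- exists t2; split=> //.
    by have := perm_size pt; rewrite size_cat st s1 mulSn => /addnI.
  by move: sumt; rewrite (perm_big _ pt) big_cat /= sum1 add0r.
- by rewrite -mset_cat; apply/eqP; rewrite mset_perm_eq.
Qed.

Lemma group_matrix_Zppow : group_matrix 'Z_(p ^ l) = diff_matrix 'Z_(p ^ l).
Proof. by apply/matrixP => i j; rewrite !mxE. Qed.

Lemma msupp_group_det m :
  (m \in msupp (group_det 'Z_(p ^ l))) <-> zero_sum_mset 1 m.
Proof.
by rewrite /group_det group_matrix_Zppow; apply: msupp_det_diff_matrix pp card_Zppow.
Qed.

(** The coefficients of the permanent are nonnegative, so that the support of a power is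
    the set of sums of elements of the support, and [zero_sum_mset_split] says which
    sums occur. *)
Lemma msupp_group_perm_exp k m :
  (m \in msupp (group_perm 'Z_(p ^ l) ^+ k)) <-> zero_sum_mset k m.
Proof.
rewrite /group_perm group_matrix_Zppow; elim: k m => [|k IHk] m.
  rewrite expr0 msupp1 inE; split=> [/eqP ->|[t [/size0nil -> _ ->]]].
    by exists [::]; rewrite /mset !big_nil.
  by rewrite /mset big_nil.
have P0 m' : 0 <= (permanent (diff_matrix 'Z_(p ^ l)))@_m'.
  by rewrite coef_permanent_diff_matrix.
rewrite exprS msuppM_nneg //; last by move=> ?; apply: coef_exp_nneg.
rewrite zero_sum_mset_split; split=> -[m1 [m2 [h1 h2 ->]]]; exists m1, m2; split=> //.
- exact/(msupp_permanent_diff_matrix _ pp card_Zppow).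
- exact/IHk.
- exact/(msupp_permanent_diff_matrix _ pp card_Zppow).
- exact/IHk.
Qed.

End CyclicSupport.

(** * Encodings of zero-sum multisets *)

Section CountTerms.

Variables (p l : nat) (pp : prime p) (l0 : (0 < l)%N).

Let n1 : (1 < p ^ l)%N.
Proof. by rewrite -(expn0 p) ltn_exp2l ?prime_gt1. Qed.

Definition residue (x : 'I_(p ^ l).+1) : 'Z_(p ^ l) := (x : nat)%:R.

(** The representative in [1 .. p ^ l], as used by [tLambda]: the class of zero is
    represented by [p ^ l]. *)
Definition pos_rep (x : 'Z_(p ^ l)) : 'I_(p ^ l).+1 :=
  inord (if x == 0 then (p ^ l)%N else x).

Lemma val_pos_rep x : pos_rep x = (if x == 0 then (p ^ l)%N else x) :> nat.
Proof.
rewrite inordK //; case: ifP => // _; rewrite ltnS ltnW //.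
by have := ltn_ord x; rewrite [X in (_ < X)%N]Zp_cast.
Qed.

Lemma pos_repK : cancel pos_rep residue.
Proof.
move=> x; apply/val_inj; rewrite /residue /= val_Zp_nat // val_pos_rep.
case: eqP => [->|_]; first by rewrite modnn.
by rewrite modn_small //; have := ltn_ord x; rewrite [X in (_ < X)%N]Zp_cast.
Qed.

Lemma pos_rep_gt0 x : (0 < pos_rep x)%N.
Proof. by rewrite val_pos_rep; case: eqP => [_|/eqP]; [apply: ltnW | rewrite -lt0n]. Qed.

Lemma residueK (x : 'I_(p ^ l).+1) : (0 < x)%N -> pos_rep (residue x) = x.
Proof.
move=> x0; apply/val_inj; rewrite /= val_pos_rep -val_eqE /= val_Zp_nat //.
have := ltn_ord x; rewrite ltnS leq_eqVlt => /predU1P [->|xn].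
  by rewrite modnn eqxx.
by rewrite modn_small // eqn0Ngt x0.
Qed.

Lemma sum_residue (t : seq 'I_(p ^ l).+1) :
  (\sum_(x <- map residue t) x == 0) = (p ^ l %| \sum_(x <- t) (x : nat))%N.
Proof.
have -> : \sum_(x <- map residue t) x = (\sum_(x <- t) (x : nat))%:R.
  by rewrite big_map natr_sum.
by rewrite /dvdn -val_Zp_nat.
Qed.

Lemma nterms_tLambda k (f : {mpoly int[#|'Z_(p ^ l)|]}) :
  (forall m, m \in msupp f <-> zero_sum_mset k m) -> nterms f = #|tLambda (p ^ l) k|.
Proof.
move=> hf; rewrite cardE -(size_map (fun t => mset (map residue (val t)))).
apply/perm_size/uniq_perm; first exact: msupp_uniq.
  rewrite map_inj_in_uniq ?enum_uniq // => t u; rewrite !mem_enum !inE.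
  move=> /and3P[/allP tp ts _] /and3P[/allP up us _] /eqP; rewrite mset_perm_eq.
  move=> /(perm_map pos_rep); rewrite -!map_comp !map_id_in; last first.
  - by move=> x /tp; apply: residueK.
  - by move=> x /up; apply: residueK.
  move=> tu; apply/val_inj; apply: (sorted_eq _ _ ts us tu).
    by move=> x y z; apply: leq_trans.
  by move=> x y /anti_leq /val_inj.
move=> m; apply/idP/mapP => [/hf [s [ss sums ->]] | [t]]; last first.
  rewrite mem_enum inE => /and3P[_ _ d] ->; apply/hf; exists (map residue t).
  split=> //; first by rewrite size_map size_tuple card_Zppow.
  by apply/eqP; rewrite sum_residue.
pose r (x y : 'I_(p ^ l).+1) := (x <= y)%N.
have st : size (sort r (map pos_rep s)) == (k * p ^ l)%N.
  by rewrite size_sort size_map ss card_Zppow.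
have ps : perm_eq (map residue (sort r (map pos_rep s))) s.
  have /(perm_map residue) := permEl (perm_sort r (map pos_rep s)).
  by rewrite (mapK pos_repK).
exists (Tuple st) => /=; last by apply/eqP; rewrite mset_perm_eq perm_sym.
rewrite mem_enum inE /=; apply/and3P; split.
- by rewrite all_sort; apply/allP => _ /mapP [x _ ->]; apply: pos_rep_gt0.
- by apply: sort_sorted => x y; apply: leq_total.
- by rewrite -sum_residue (perm_big _ ps) sums.
Qed.

(** The same multisets by multiplicities: [c x] is the number of occurrences of [x]. The
    bound on the values only serves to have a finite type. This form is suited to
    generating functions. *)
Definition zero_sum_contents k : {set {ffun 'Z_(p ^ l) -> 'I_(k * p ^ l).+1}} :=
  [set c : {ffun 'Z_(p ^ l) -> 'I_(k * p ^ l).+1} |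
    (\sum_x (c x : nat) == k * p ^ l)%N && (p ^ l %| \sum_x c x * x)%N].

Lemma count_flatten_nseq (T : finType) (c : T -> nat) y :
  count_mem y (flatten [seq nseq (c x) x | x <- enum T]) = c y.
Proof.
rewrite count_flatten -map_comp sumnE big_map big_enum /= (bigD1 y) //=.
rewrite count_nseq /= eqxx mul1n big1 ?addn0 // => x xy.
by rewrite count_nseq /= (negbTE xy).
Qed.

Lemma nterms_zero_sum_contents k (f : {mpoly int[#|'Z_(p ^ l)|]}) :
  (forall m, m \in msupp f <-> zero_sum_mset k m) -> nterms f = #|zero_sum_contents k|.
Proof.
move=> hf; pose F (c : {ffun 'Z_(p ^ l) -> 'I_(k * p ^ l).+1}) :=
  flatten [seq nseq (c x) x | x <- enum 'Z_(p ^ l)].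
have sF c : size (F c) = (\sum_x c x)%N.
  rewrite size_flatten /shape -map_comp sumnE big_map big_enum /=.
  by apply: eq_bigr => x _; rewrite size_nseq.
have sumF c : (\sum_(x <- F c) x == 0) = (p ^ l %| \sum_x c x * x)%N.
  rewrite sum_Zppow_eq0 // big_flatten big_map big_enum /=; congr (_ %| _)%N.
  by apply: eq_bigr => x _; rewrite big_nseq iter_addn_0 mulnC.
rewrite cardE -(size_map (fun c => mset (F c))).
apply/perm_size/uniq_perm; first exact: msupp_uniq.
  rewrite map_inj_in_uniq ?enum_uniq // => c d _ _ /eqP; rewrite mset_perm_eq.
  move=> /seq.permP e; apply/ffunP => x; apply/val_inj.
  by have := e (pred1 x); rewrite !count_flatten_nseq.
move=> m; apply/idP/mapP => [/hf [s [ss sums ->]] | [c]]; last first.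
  rewrite mem_enum inE => /andP[/eqP c1 c2] ->; apply/hf; exists (F c).
  split=> //; first by rewrite sF c1 card_Zppow.
  by apply/eqP; rewrite sumF.
pose c : {ffun 'Z_(p ^ l) -> 'I_(k * p ^ l).+1} := [ffun x => inord (count_mem x s)].
have ce x : c x = count_mem x s :> nat.
  by rewrite ffunE inordK // ltnS (leq_trans (count_size _ _)) // ss card_Zppow.
have ps : perm_eq s (F c).
  by apply/allP => x _ /=; rewrite count_flatten_nseq ce.
exists c; last by apply/eqP; rewrite mset_perm_eq.
rewrite mem_enum inE -sF -sumF -(perm_size ps) ss card_Zppow // eqxx /=.
by rewrite -(perm_big _ ps) sums.
Qed.

End CountTerms.

(** * Counting zero-sum multisets with roots of unity *)

Lemma big_period (R : Type) (idx : R) (op : Monoid.law idx) (h : nat -> R) e g :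
  (forall i, h (i + e)%N = h i) ->
  \big[op/idx]_(i < g * e) h i = iter g (op (\big[op/idx]_(i < e) h i)) idx.
Proof.
move=> he; elim: g => [|g IHg]; first by rewrite mul0n big_ord0.
rewrite mulSn big_split_ord /= -IHg; congr (op _ _).
by apply: eq_bigr => i _; rewrite addnC he.
Qed.

Section RootsOfUnityCount.

Variables (F : fieldType).
Implicit Types (w : F).

(** The geometric series truncated after degree [M]. Polynomials modulo ['X^(M.+1)]
    replace power series in what follows. *)
Definition geom (M : nat) w : {poly F} := \poly_(i < M.+1) w ^+ i.

Lemma geom_mul M w :
  (1 - w *: 'X) * geom M w = 1 - w ^+ M.+1 *: 'X^(M.+1).
Proof.
rewrite /geom poly_def; elim: M => [|M IHM].
  by rewrite big_ord1 expr0 scale1r expr0 mulr1 expr1 expr1.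
rewrite big_ord_recr /= mulrDr IHM mulrBl mul1r -scalerAl -scalerAr scalerA -!exprS.
by rewrite addrA subrK.
Qed.

(** The reversal of the factorization of ['X^e - 1]. *)
Lemma prod_one_sub_root e w : e.-primitive_root w ->
  \prod_(i < e) (1 - w ^+ i *: 'X) = 1 - 'X^e.
Proof.
move=> prim; have e0 := prim_order_gt0 prim.
have w0 : w != 0.
  apply: contra_eq_neq (prim_expr_order prim) => ->.
  by rewrite expr0n gtn_eqF // eq_sym oner_eq0.
have primV : e.-primitive_root w^-1.
  have -> : w^-1 = w ^+ e.-1.
    by apply: (mulfI w0); rewrite divff // -exprS prednK // prim_expr_order.
  rewrite (prim_root_exp_coprime _ prim).
  by case: e e0 {prim} => // e _; rewrite /= coprimenS.
set P := (X in X = _).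
have [c Pc] : exists c, P = c *: ('X^e - 1).
  rewrite -(factor_Xn_sub_1 primV) big_mkord.
  exists (\prod_(i < e) (- w ^+ i)); rewrite -scaler_prod.
  apply: eq_bigr => i _; rewrite scalerBr !scaleNr opprK [RHS]addrC.
  by congr (_ - _); rewrite -mul_polyC -polyCM -exprMn divff // expr1n.
have : P.[0] = 1.
  by rewrite horner_prod big1 // => i _; rewrite !hornerE ?mulr0 ?subr0.
rewrite Pc !hornerE expr0n gtn_eqF // add0r mulrN1 => /(canRL opprK) ->.
by rewrite scaleN1r opprB.
Qed.

(** The expansion of [(1 - 'X) ^- g], truncated. For [g = 0] the truncated subtraction
    still gives the coefficients of the constant 1. *)
Definition multichoose_poly M g : {poly F} :=
  \poly_(i < M.+1) ('C(i + g - 1, i))%:R.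

Lemma multichoose_poly_mul M g :
  exists T, (1 - 'X) ^+ g * multichoose_poly M g = 1 + 'X^(M.+1) * T.
Proof.
elim: g => [|g [T IHg]].
  exists 0; rewrite mulr0 addr0 expr0 mul1r /multichoose_poly poly_def big_ord_recl /=.
  rewrite bin0 scale1r expr0 big1 ?addr0 // => i _.
  by rewrite bin_small ?scale0r // /bump; lia.
exists (T - (1 - 'X) ^+ g * ('C(M + g, M))%:R%:P).
have -> : (1 - 'X) ^+ g.+1 * multichoose_poly M g.+1 =
   (1 - 'X) ^+ g * ((1 - 'X) * multichoose_poly M g.+1) by rewrite exprSr mulrA.
have -> : (1 - 'X) * multichoose_poly M g.+1 =
    multichoose_poly M g - 'X^(M.+1) * ('C(M + g, M))%:R%:P.
  apply/polyP => i; rewrite mulrBl mul1r !coefB coefXM coefXnM !coef_poly coefC.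
  case: i => [|i] /=; first by rewrite !bin0 !subr0.
  have -> : (i.+1 + g.+1 - 1 = (i + g).+1)%N by lia.
  have -> : (i + g.+1 - 1 = i + g)%N by lia.
  have -> : (i.+1 + g - 1 = i + g)%N by lia.
  rewrite binS natrD; case: (ltngtP i M) => [iM|iM|->].
  - by rewrite !ltnS iM ltnW // subr0 addrK.
  - have [-> -> ->] : [/\ (i.+1 < M.+1)%N = false, (i < M.+1)%N = false
        & (i - M == 0)%N = false] by split; lia.
    by [].
  - by rewrite ltnS leqnn !ltnn subnn eqxx.
by rewrite mulrBr IHg; ring.
Qed.

End RootsOfUnityCount.

Section CoefProdGeom.

Variable F : fieldType.

Lemma prod_one_add_mul (R : comNzRingType) (I : Type) (r : seq I) (y : R) (t : I -> R) :
  exists T, \prod_(i <- r) (1 + y * t i) = 1 + y * T.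
Proof.
elim: r => [|i r [T IHr]]; first by exists 0; rewrite big_nil mulr0 addr0.
by exists (t i + T + y * t i * T); rewrite big_cons IHr; ring.
Qed.

(** Both the product of geometric series and the expansion of [(1 - 'X^e) ^- g] are
    inverses of [(1 - 'X^e) ^+ g] modulo ['X^(M.+1)], hence agree up to degree [M]. *)
Lemma coef_prod_geom M e g (w : F) m : e.-primitive_root w -> (m <= M)%N -> (e %| m)%N ->
  (\prod_(i < g * e) geom M (w ^+ i))`_m = ('C(m %/ e + g - 1, m %/ e))%:R.
Proof.
move=> prim mM em; have e0 := prim_order_gt0 prim.
set Q := \prod_(i < _) _; pose A : {poly F} := (1 - 'X^e) ^+ g.
pose R := multichoose_poly F M g \Po 'X^e.
(* [T1] and [T2] are the errors of the two truncated inverses [Q] and [R] of [A]. *)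
have [T1 QA] : exists T, Q * A = 1 + 'X^(M.+1) * T.
  have -> : A = \prod_(i < g * e) (1 - w ^+ i *: 'X).
    rewrite (@big_period _ _ _ (fun i => 1 - w ^+ i *: 'X)) => [|i]; last first.
      by rewrite exprD (prim_expr_order prim) mulr1.
    by rewrite prod_one_sub_root // iter_mulr_1.
  rewrite -big_split /=.
  have [T eT] := prod_one_add_mul (index_enum 'I_(g * e)) 'X^(M.+1)
    (fun i : 'I_(g * e) => - ((w ^+ i) ^+ M.+1)%:P).
  exists T; rewrite -eT; apply: eq_bigr => i _.
  by rewrite mulrC geom_mul mulrN mulrC mul_polyC.
have [T2 RA] : exists T, A * R = 1 + 'X^(M.+1) * T.
  have [T eT] := multichoose_poly_mul F M g.
  exists ('X^(e.-1 * M.+1) * (T \Po 'X^e)).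
  have -> : A = ((1 - 'X) ^+ g) \Po 'X^e.
    by rewrite rmorphXn /= rmorphB /= comp_polyC comp_polyX.
  rewrite -comp_polyM eT comp_polyD comp_polyM comp_polyC comp_Xn_poly.
  rewrite -exprM mulrA -exprD.
  by congr (1 + 'X^_ * _); nia.
have -> : Q = R + 'X^(M.+1) * (T1 * R - Q * T2).
  have -> : R + 'X^(M.+1) * (T1 * R - Q * T2) =
      (1 + 'X^(M.+1) * T1) * R - Q * ('X^(M.+1) * T2) by ring.
  by rewrite -QA -[X in _ - _ * X](addKr 1) -RA; ring.
rewrite coefD coefXnM ltnS mM addr0 coef_comp_poly_Xn // em coef_poly ltnS.
by rewrite (leq_trans (leq_div _ _) mM).
Qed.

Lemma sum_prim_root N (z : F) s : N.-primitive_root z ->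
  \sum_(j < N) z ^+ (j * s) = if (N %| s)%N then N%:R else 0.
Proof.
move=> prim; have N0 := prim_order_gt0 prim.
rewrite (eq_bigr (fun j : 'I_N => (z ^+ s) ^+ j)) => [|j _]; last by rewrite mulnC exprM.
rewrite (prim_order_dvd prim); case: eqP => [->|/eqP zs].
  by rewrite (eq_bigr (fun=> 1)) ?sumr_const ?card_ord // => j _; rewrite expr1n.
have := subrX1 (z ^+ s) N; rewrite -exprM mulnC exprM (prim_expr_order prim) expr1n subrr.
by move/esym/eqP; rewrite mulf_eq0 subr_eq0 (negbTE zs) /= => /eqP.
Qed.

End CoefProdGeom.

(** Detect divisibility of the weighted sum by averaging over [N]-th roots of unity; for
    each root, sum over all [c] with the given total by reading a coefficient in
    a product of geometric series. *)
Lemma card_contents_eq N M k : (0 < N)%N -> (k * N <= M)%N ->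
  (N * #|[set c : {ffun 'I_N -> 'I_M.+1} |
      (\sum_x (c x : nat) == k * N) && (N %| \sum_x c x * x)]| =
   \sum_(j < N) 'C(k * gcdn j N + gcdn j N - 1, k * gcdn j N))%N.
Proof.
move=> N0 kM; have [z prim] := C_prim_root_exists N0.
apply/eqP; rewrite -(eqr_nat algC) natrM natr_sum; apply/eqP/esym.
transitivity (\sum_(j < N) (\prod_(i < N) geom M ((z ^+ j) ^+ i))`_(k * N)).
  apply: eq_bigr => j _; set g := gcdn j N.
  have gN : (g %| N)%N by apply: dvdn_gcdr.
  have g0 : (0 < g)%N by rewrite gcdn_gt0 N0 orbT.
  have gE : (g * (N %/ g) = N)%N by rewrite mulnC divnK.
  rewrite -(big_mkord xpredT (fun i => geom M ((z ^+ j) ^+ i))).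
  rewrite -[X in \prod_(0 <= _ < X) _]gE big_mkord coef_prod_geom //; last 2 first.
  - exact: exp_prim_root.
  - by rewrite dvdn_mull // -{2}gE dvdn_mull.
  have -> // : (k * N %/ (N %/ g) = k * g)%N.
  by rewrite -{1}gE mulnA mulnK // divn_gt0 // dvdn_leq.
transitivity (\sum_(c : {ffun 'I_N -> 'I_M.+1} | (\sum_x (c x : nat) == k * N)%N)
    \sum_(j < N) z ^+ (j * \sum_x c x * x)).
  rewrite exchange_big /=; apply: eq_bigr => j _.
  rewrite (eq_bigr (fun i : 'I_N =>
      \sum_(a < M.+1) ((z ^+ j) ^+ i) ^+ a *: 'X^a)); last first.
    by move=> i _; rewrite /geom poly_def.
  rewrite bigA_distr_bigA coef_sum [RHS]big_mkcond /=; apply: eq_bigr => c _.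
  rewrite scaler_prod -expr_sum coefZ coefXn eq_sym.
  case: eqP => _; rewrite ?mulr0 // mulr1.
  rewrite exprM expr_sum; apply: eq_bigr => i _.
  by rewrite -exprM mulnC.
rewrite (eq_bigr _ (fun c _ => sum_prim_root _ prim)) -big_mkcondr sumr_const.
rewrite -[LHS]mulr_natr; congr (_ * _%:R); apply: eq_card => c; by rewrite inE.
Qed.

(** * Binomial coefficients at consecutive powers of a prime *)

Lemma sum_dvdn (d m : nat) : (0 < d)%N -> (\sum_(j < m * d) (d %| j) = m)%N.
Proof.
move=> d0; rewrite (@big_period _ _ _ (fun j => nat_of_bool (d %| j)%N)); last first.
  by move=> j; rewrite dvdn_addl.
rewrite (_ : (\sum_(i < d) _)%N = 1%N); first by rewrite iter_addn_0 mul1n.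
rewrite (bigD1 (Ordinal d0)) //= dvdn0 big1 // => i i0.
by rewrite gtnNdvd // lt0n.
Qed.

(** Write [g (gcdn j (p ^ l))] as [g 1] plus a telescoping sum over the powers of [p]
    dividing [j], and count the multiples of each power. *)
Lemma sum_gcdn_ppow (p l : nat) (g : nat -> int) : prime p ->
  \sum_(j < p ^ l) g (gcdn j (p ^ l)) =
  g 1%N *+ p ^ l + \sum_(i < l) (g (p ^ i.+1)%N - g (p ^ i)%N) *+ p ^ (l - i.+1).
Proof.
move=> pp; have p0 := prime_gt0 pp.
transitivity (\sum_(j < p ^ l) (g 1%N +
    \sum_(i < l) (g (p ^ i.+1)%N - g (p ^ i)%N) *+ (p ^ i.+1 %| j)%N)).
  apply: eq_bigr => j _; have /(dvdn_pfactor _ _ pp) [v vl ev] := dvdn_gcdr j (p ^ l).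
  rewrite [in LHS]ev.
  pose d i := g (p ^ i.+1)%N - g (p ^ i)%N.
  rewrite (eq_bigr (fun i : 'I_l => if (i < v)%N then d i else 0)).
    rewrite -big_mkcond -(big_ord_widen _ d vl) -(big_mkord xpredT d).
    by rewrite (telescope_sumr (fun i => g (p ^ i)%N)) // addrC subrK.
  move=> i _; have -> : (p ^ i.+1 %| j)%N = (i < v)%N.
    rewrite -(dvdn_Pexp2l _ _ (prime_gt1 pp)) -ev dvdn_gcd.
    by rewrite (dvdn_exp2l _ (ltn_ord i)) andbT.
  by case: ifP; rewrite ?mulr1n ?mulr0n.
rewrite big_split /= sumr_const card_ord; congr (_ + _).
rewrite exchange_big /=; apply: eq_bigr => i _; rewrite sumrMnr; congr (_ *+ _).
by rewrite -[RHS](@sum_dvdn (p ^ i.+1)) ?expn_gt0 ?p0 // -expnD subnK.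
Qed.

Lemma bin_rising_prod a m : ('C(a + m, m) * m`! = \prod_(1 <= j < m.+1) (a + j))%N.
Proof.
elim: m => [|m IHm]; first by rewrite big_geq // bin0.
rewrite big_nat_recr //= -IHm factS mulnA [(_ * m.+1)%N]mulnC addnS -mul_bin_diag /=.
by rewrite -mulnA mulnC.
Qed.

(** Taking [m.+1] keeps the factor for [j = 0] out of both sides. *)
Lemma prod_split_multiples (R : comNzRingType) (F : nat -> R) p m : (0 < p)%N ->
  \prod_(1 <= j < p * m.+1) F j =
  \prod_(1 <= j < p * m.+1 | ~~ (p %| j)%N) F j * \prod_(1 <= j < m.+1) F (p * j)%N.
Proof.
move=> p0; rewrite (bigID (fun j => p %| j)%N) /= mulrC; congr (_ * _).
elim: m => [|m IHm].
  rewrite [RHS]big_geq // big_seq_cond big1 // => j; rewrite mem_index_iota muln1.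
  by case/andP=> /andP[j0 jp]; rewrite gtnNdvd.
rewrite (@big_cat_nat _ _ _ (p * m.+1)) ?muln_gt0 ?p0 // /=; last by rewrite leq_pmul2l.
rewrite IHm [RHS]big_nat_recr //=; congr (_ * _).
rewrite big_ltn_cond ?ltn_pmul2l // dvdn_mulr // big_seq_cond big1 ?mulr1 // => j.
rewrite mem_index_iota => /andP[/andP[j1 j2]].
rewrite -(subnKC (ltnW j1)) dvdn_addr ?dvdn_mulr // gtnNdvd //; lia.
Qed.

Section BinomialCongruence.

Variables (p : nat) (pp : prime p) (p5 : (5 <= p)%N).

(** Substituting [2 * x] for [x] multiplies the sum by [1 / 4], and [p] does not divide
    3. The term at [x = 0] is zero. *)
Lemma sum_Fp_inv_sqr : \sum_(x : 'F_p) x ^- 2 = 0.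
Proof.
have n2 : (2%:R : 'F_p) != 0.
  by rewrite -(dvdn_pcharf (pchar_Fp pp)) gtnNdvd //; lia.
have n3 : (3%:R : 'F_p) != 0.
  by rewrite -(dvdn_pcharf (pchar_Fp pp)) gtnNdvd //; lia.
set S := (X in X = _); have : S = 4%:R^-1 * S.
  rewrite {1}/S (reindex_inj (mulfI n2)) /= mulr_sumr; apply: eq_bigr => x _.
  by rewrite exprMn invfM -natrX.
have n4 : (4%:R : 'F_p) != 0 by rewrite -[4%N]/(2 * 2)%N natrM mulf_neq0.
move=> eS; have e : 4%:R * S = S by rewrite [in LHS]eS mulrA divff // mul1r.
have /eqP : 3%:R * S = 0.
  by rewrite (_ : 3%:R = 4%:R - 1 :> 'F_p) ?mulrBl ?mul1r ?e ?subrr //; ring.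
by rewrite mulf_eq0 (negbTE n3) => /eqP.
Qed.

Lemma sum_inv_sqr_period e : \sum_(0 <= j < p ^ e.+1) (j%:R : 'F_p) ^- 2 = 0.
Proof.
rewrite big_mkord expnSr (@big_period _ _ _ (fun j => (j%:R : 'F_p) ^- 2)); last first.
  by move=> j; rewrite natrD pchar_Fp_0 // addr0.
suff -> : \sum_(j < p) (j%:R : 'F_p) ^- 2 = 0 by rewrite iter_addr_0 mul0rn.
pose f j := (j%:R : 'F_p) ^- 2.
have ext N : N = p -> \sum_(j < p) f j = \sum_(j < N) f j by move=> ->.
rewrite (ext _ (Fp_cast pp)) -[RHS]sum_Fp_inv_sqr; apply: eq_bigr => x _.
by rewrite /f natr_Zp.
Qed.

(** First order expansion of a product in [y], with the linear coefficient identified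
    modulo [p]. *)
Lemma prod_add_expand (r : seq nat) (u : nat -> int) (y : int) :
  (forall j, j \in r -> (u j)%:~R != 0 :> 'F_p) ->
  exists S T : int, \prod_(j <- r) (u j + y) = \prod_(j <- r) u j + y * S + y ^+ 2 * T
    /\ S%:~R = (\prod_(j <- r) u j)%:~R * \sum_(j <- r) ((u j)%:~R)^-1 :> 'F_p.
Proof.
elim: r => [|j r IHr] h.
  by exists 0, 0; rewrite !big_nil; split; rewrite ?mulr0 //; ring.
have [|S [T [e1 e2]]] := IHr; first by move=> i ir; apply: h; rewrite inE ir orbT.
exists (u j * S + \prod_(j <- r) u j), (u j * T + S + y * T); rewrite !big_cons; split.
  by rewrite e1; ring.
have uj := h j (mem_head _ _).
by rewrite rmorphD !rmorphM /= e2; field.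
Qed.


Definition coprime_prod (m : nat) (F : nat -> int) : int :=
  \prod_(1 <= j < m | ~~ (p %| j)%N) F j.

Lemma coprimez_ppow n (x : int) : x%:~R != 0 :> 'F_p -> coprimez (p ^ n)%N%:Z x.
Proof.
move=> x0; rewrite coprimezE absz_nat coprimeXl // prime_coprime //.
by rewrite -[p in (p %| _)%N]absz_nat -dvdzE (dvdz_pcharf (pchar_Fp pp)).
Qed.

Lemma coprime_prod_neq0 m : (coprime_prod m Posz)%:~R != 0 :> 'F_p.
Proof.
rewrite /coprime_prod rmorph_prod /= prodf_seq_neq0; apply/allP => j _ /=.
by rewrite -pmulrn -(dvdn_pcharf (pchar_Fp pp)); apply/implyP.
Qed.

(** Call the two products [N] and [D], and [q] the prime power. Pairing [j] with
    [q - j] gives [N ^+ 2 = \prod (u j + y)] and [D ^+ 2 = \prod u j], where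
    [u j = j * (q - j)] and [y = k * k.+1 * q ^ 2] does not depend on [j]. The term of
    first order in [y] gains a factor [p] from the vanishing of the sum of inverse
    squares, and squares can be removed because [N + D] is prime to [p]. *)
Lemma coprime_prod_congr e k :
  ((p ^ (2 * e + 3))%N%:Z %|
    coprime_prod (p ^ e.+1) (fun j => (k * p ^ e.+1 + j)%N%:Z) -
    coprime_prod (p ^ e.+1) Posz)%Z.
Proof.
set q := (p ^ e.+1)%N; pose P := coprime_prod q; rewrite -/(P _) -/(P Posz).
set N := P (fun j => _); set D := P Posz.
have p0 := prime_gt0 pp.
have pq : (p %| q)%N by rewrite /q expnS dvdn_mulr.
have q0 : q%:R = 0 :> 'F_p by apply/eqP; rewrite -(dvdn_pcharf (pchar_Fp pp)).
have rev F : P F = P (fun j => F (q - j)%N).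
  rewrite /P /coprime_prod big_nat_rev /= add1n big_nat_cond [RHS]big_nat_cond.
  apply: eq_big => [j|j _]; last by rewrite subSS.
  rewrite subSS; case: (boolP (1 <= j < q)%N) => //= /andP[j0 jq].
  by rewrite dvdn_subr // ltnW.
pose r := [seq j <- index_iota 1 q | ~~ (p %| j)%N].
have rP j : j \in r -> [/\ (0 < j)%N, (j < q)%N & j%:R != 0 :> 'F_p].
  by rewrite mem_filter mem_index_iota (dvdn_pcharf (pchar_Fp pp)) => /andP[? /andP[]].
have Pr F : P F = \prod_(j <- r) F j by rewrite /P /coprime_prod big_filter.
pose u j := (j * (q - j))%N%:Z; pose y := (k * k.+1 * q ^ 2)%N%:Z.
(* Modulo [p] one has [q - j = - j]: the inverse of [u j] is minus an inverse square. *)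
have uF j : (j < q)%N -> (u j)%:~R = - j%:R ^+ 2 :> 'F_p.
  by move=> jq; rewrite /u -pmulrn natrM natrB ?q0 1?ltnW //; ring.
have D2 : D ^+ 2 = \prod_(j <- r) u j.
  by rewrite expr2 {2}/D rev /D !Pr -big_split /=; apply: eq_bigr => j _; rewrite -PoszM.
have N2 : N ^+ 2 = \prod_(j <- r) (u j + y).
  rewrite expr2 {2}/N rev /N !Pr -big_split /=; apply: eq_big_seq => j /rP[_ jq _].
  rewrite -PoszM /u /y -PoszD; congr Posz.
  by move: (q - j)%N (esym (subnKC (ltnW jq))) => t ->; rewrite -addn1; ring.
have [|S [T [e1 e2]]] := @prod_add_expand r u y.
  by move=> j /rP[_ jq j0]; rewrite uF // oppr_eq0 expf_neq0.
have pS : (p%:Z %| S)%Z.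
  rewrite (dvdz_pcharf (pchar_Fp pp)) e2.
  rewrite [X in _ * X](eq_big_seq (fun j => - (j%:R ^- 2))).
    suff -> : \sum_(j <- r) - (j%:R ^- 2) = - \sum_(0 <= j < q) j%:R ^- 2 :> 'F_p.
      by rewrite sum_inv_sqr_period oppr0 mulr0.
    have q_gt0 : (0 < q)%N by rewrite expn_gt0 p0.
    rewrite sumrN big_filter big_mkcond [in RHS]big_ltn //= expr0n invr0 add0r.
    congr (- _); apply: eq_bigr => j _; rewrite (dvdn_pcharf (pchar_Fp pp)).
    by case: eqP => //= ->; rewrite expr0n invr0.
  by move=> j /rP[_ jq _]; rewrite uF // invrN.
have cop : coprimez (p ^ (2 * e + 3))%N%:Z (N + D).
  apply: coprimez_ppow; rewrite rmorphD /=.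
  have -> : N%:~R = D%:~R :> 'F_p.
    rewrite /N /D !Pr !rmorph_prod /=; apply: eq_bigr => j _.
    by rewrite -!pmulrn natrD natrM q0 mulr0 add0r.
  rewrite -mulr2n -mulr_natr mulf_neq0 ?coprime_prod_neq0 //.
  by rewrite -(dvdn_pcharf (pchar_Fp pp)) gtnNdvd //; lia.
(* Both terms are divisible: [y] by [q ^ 2], [S] by [p], and [y ^+ 2] by [q ^ 4]. *)
rewrite -(Gauss_dvdzl _ cop) -subr_sqr N2 e1 D2.
rewrite (_ : _ - _ = y * S + y ^+ 2 * T); last by ring.
have [s ->] := dvdzP pS.
apply/dvdzP; exists ((k * k.+1)%N%:Z * s + ((k * k.+1) ^ 2 * p ^ (2 * e + 1))%N%:Z * T).
rewrite mulrDl; congr (_ + _).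
  rewrite /y /q -expnM.
  have -> : (p ^ (2 * e + 3) = p ^ (e.+1 * 2) * p)%N by rewrite -expnSr; congr expn; lia.
  by rewrite !PoszM; ring.
have e4 : ((q ^ 2) ^ 2 = p ^ (2 * e + 1) * p ^ (2 * e + 3))%N.
  by rewrite /q -!expnM -expnD; congr expn; lia.
by rewrite -[y ^+ 2]PoszM mulnn expnMn e4 !PoszM; ring.
Qed.

Lemma prod_multiples k m :
  \prod_(1 <= j < (p * m.+1)) (k * (p * m.+1) + j)%N%:Z =
  coprime_prod (p * m.+1) (fun j => (k * (p * m.+1) + j)%N%:Z) *
    (p ^ m * ('C(k * m.+1 + m, m) * m`!))%N%:Z.
Proof.
have p0 := prime_gt0 pp; rewrite (prod_split_multiples _ _ p0) /=; congr (_ * _).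
rewrite bin_rising_prod PoszM -[(\prod_(_ <= _ < _) _)%N%:Z]natz natr_prod.
have -> : (p ^ m)%N%:Z = \prod_(1 <= j < m.+1) p%:Z.
  by rewrite big_const_nat subSS subn0 iter_mulr_1 -!natz natrX.
rewrite -big_split /=; apply: eq_bigr => j _; rewrite natz -PoszM; congr Posz; lia.
Qed.

(** Numerator and denominator of the first binomial coefficient, restricted to the
    multiples of [p], give the second one; the remaining factors are compared by
    [coprime_prod_congr]. *)
Lemma bin_ppow_congr e k :
  ((p ^ (2 * e + 3))%N%:Z %|
    ('C(k * p ^ e.+1 + p ^ e.+1 - 1, k * p ^ e.+1))%:Z -
    ('C(k * p ^ e + p ^ e - 1, k * p ^ e))%:Z)%Z.
Proof.
have p0 := prime_gt0 pp; have q0 : (0 < p ^ e)%N by rewrite expn_gt0 p0.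
have := coprime_prod_congr e k; rewrite expnS.
move: (p ^ e)%N q0 => [//|m] _; set N := coprime_prod _ _; set D := coprime_prod _ _.
have binE a g : ('C(a + g.+1 - 1, a) = 'C(a + g, g))%N.
  by rewrite addnS subn1 /= -(@bin_sub _ a) ?leq_addr // addKn.
rewrite (binE (k * m.+1)%N m); set q := (p * m.+1)%N.
have [r qr] : exists r, q = r.+1 by exists q.-1; rewrite prednK // muln_gt0 p0.
have risingE a : \prod_(1 <= j < q) (a + j)%N%:Z = ('C(a + r, r) * r`!)%N%:Z.
  by rewrite bin_rising_prod -natz natr_prod -qr; apply: eq_bigr => j _; rewrite natz.
have := prod_multiples k m; have := prod_multiples 0 m.
rewrite -/q !risingE mul0n !add0n !binn !mul1n -/N -/D => eD eN.
rewrite {2}qr (binE (k * q)%N r) => dvdND.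
set A := ('C(_, r))%:Z; set c := ('C(_, m))%:Z.
(* Cancel the power of [p] and the factorial coming from the multiples of [p]. *)
have AD : A * D = N * c.
  have X0 : (p ^ m * m`!)%N%:Z != 0.
    by rewrite eqz_nat -lt0n muln_gt0 expn_gt0 p0 fact_gt0.
  apply: (mulIf X0); move: eN; rewrite !PoszM -/A -/c eD !PoszM.
  by move=> eN; rewrite -mulrA eN; ring.
have copD := coprimez_ppow (2 * e + 3) (coprime_prod_neq0 q).
rewrite -(Gauss_dvdzl _ copD) mulrBl AD (_ : _ - _ = c * (N - D)); last by ring.
exact: dvdz_mull.
Qed.

End BinomialCongruence.

(** * The number of zero-sum multisets modulo powers of the prime *)

Section CountModulo.

Variables (p l : nat) (pp : prime p) (l0 : (0 < l)%N).

Let n1 : (1 < p ^ l)%N.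
Proof. by rewrite -(expn0 p) ltn_exp2l ?prime_gt1. Qed.

(** The general count with ['Z_(p ^ l)] identified with the integers below [p ^ l]. *)
Lemma card_zero_sum_contents k :
  (p ^ l * #|zero_sum_contents p l k| =
   \sum_(j < p ^ l) 'C(k * gcdn j (p ^ l) + gcdn j (p ^ l) - 1, k * gcdn j (p ^ l)))%N.
Proof.
have N_eq := Zp_cast n1.
have h := @card_contents_eq (Zp_trunc (p ^ l)).+2 (k * p ^ l) k isT.
have {}h := h ltac:(by rewrite N_eq).
pose f N := (\sum_(j < N) 'C(k * gcdn j N + gcdn j N - 1, k * gcdn j N))%N.
have ext N : N = (p ^ l)%N -> f N = f (p ^ l)%N by move=> ->.
rewrite -[RHS](ext _ N_eq) /f -h; congr muln; first by rewrite N_eq.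
apply: eq_card => c; rewrite !inE; congr ((_ == (k * _)) && (_ %| _))%N; exact: esym.
Qed.

(** By [sum_gcdn_ppow], [p ^ l] times the cardinal is [p ^ l] plus the sum of the
    differences of consecutive binomial coefficients, the [i]-th weighted by
    [p ^ (l - i.+1)]. *)
Lemma zero_sum_contents_mod k s :
  (forall i, (i < l)%N -> ((p ^ (i.+1 + s))%N%:Z %|
    ('C(k * p ^ i.+1 + p ^ i.+1 - 1, k * p ^ i.+1))%:Z -
    ('C(k * p ^ i + p ^ i - 1, k * p ^ i))%:Z)%Z) ->
  #|zero_sum_contents p l k| = 1 %[mod p ^ s].
Proof.
move=> hd; have p0 := prime_gt0 pp; set X := #|_|.
pose g d : int := ('C(k * d + d - 1, k * d))%:Z.
have eX : (p ^ l)%N%:Z * X%:Z =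
    (p ^ l)%N%:Z + \sum_(i < l) (g (p ^ i.+1)%N - g (p ^ i)%N) *+ p ^ (l - i.+1).
  rewrite -PoszM card_zero_sum_contents -natz natr_sum.
  rewrite (eq_bigr (fun j : 'I_(p ^ l) => g (gcdn j (p ^ l)))); last first.
    by move=> j _; rewrite natz.
  by rewrite sum_gcdn_ppow // {1}/g !muln1 addnK binn natz.
apply/eqP; rewrite -eqz_nat -!modz_nat eqz_mod_dvd.
have pl0 : (p ^ l)%N%:Z != 0 by rewrite eqz_nat -lt0n expn_gt0 p0.
rewrite -(dvdz_mul2l pl0) mulrBr mulr1 eX addrC addKr -PoszM -expnD.
apply: rpred_sum => i _; have il := ltn_ord i.
have -> : (l + s = (l - i.+1) + (i.+1 + s))%N by lia.
by rewrite -mulr_natl natz expnD PoszM dvdz_mul // hd.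
Qed.

End CountModulo.

Theorem corollary1p6 (p : nat) (p_prime : prime p) (p_ge5 : (5 <= p)%N) :
  (forall k l : nat, (1 <= k)%N -> (1 <= l)%N ->
     nterms (group_perm 'Z_(p ^ l) ^+ k) = #|tLambda (p ^ l) k| /\
     #|tLambda (p ^ l) k| = 1 %[mod p ^ 2]) /\
  (wolstenholme_prime p -> forall l : nat, (1 <= l)%N ->
     [/\ nterms (group_det 'Z_(p ^ l)) = nterms (group_perm 'Z_(p ^ l)),
         nterms (group_perm 'Z_(p ^ l)) = #|tLambda (p ^ l) 1|
       & #|tLambda (p ^ l) 1| = 1 %[mod p ^ 3]]).
Proof.
have perm_exp k l : (0 < l)%N ->
    nterms (group_perm 'Z_(p ^ l) ^+ k) = #|tLambda (p ^ l) k| /\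
    #|tLambda (p ^ l) k| = #|zero_sum_contents p l k|.
  move=> l0; have supp := msupp_group_perm_exp p_prime l0 k.
  rewrite -(nterms_zero_sum_contents p_prime l0 supp).
  by rewrite -(nterms_tLambda p_prime l0 supp).
split=> [k l _ l0 | [_ wol] l l0].
  have [-> ->] := perm_exp k l l0; split=> //.
  apply: zero_sum_contents_mod => // i il.
  apply: dvdz_trans (bin_ppow_congr p_prime p_ge5 i k).
  by rewrite dvdzE !absz_nat dvdn_exp2l //; lia.
have [tl1 cl] := perm_exp 1%N l l0; rewrite expr1 in tl1; split=> //.
  by rewrite tl1; apply: nterms_tLambda => // m; apply: msupp_group_det.
rewrite cl; apply: zero_sum_contents_mod => // -[|i] il.
  (* The general congruence only gives [p ^ 3] here, where [p ^ 4] is required. *)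
  have -> : ('C(1 * p ^ 1 + p ^ 1 - 1, 1 * p ^ 1) = 'C(2 * p - 1, p - 1))%N.
    by rewrite mul1n expn1 -(@bin_sub _ p); [congr binomial; lia | lia].
  by rewrite expn0 -eqz_mod_dvd !modz_nat eqz_nat; apply/eqP.
apply: dvdz_trans (bin_ppow_congr p_prime p_ge5 i.+1 1).
by rewrite dvdzE !absz_nat dvdn_exp2l //; lia.
Qed.
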